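(* Let $k$ be a positive integer, let $\mathcal{X}$ and $\mathcal{Y}$ be $k$-labeled metric spaces and fix a nonnegative integer $j$. The associated labeled persistent homology modules satisfy $$\mathsf{Int}(\mathrm{LPH}_j(\mathcal{X}),\mathrm{LPH}_j(\mathcal{Y}))\le 2\cdot\mathsf{GH}_k(\mathcal{X},\mathcal{Y}).$$
   Context: A $k$-labeled metric space is a triple $\mathcal{X}=(X,d_X,L_X)$, where $(X,d_X)$ is a compact metric space and $L_X=(X_1,\ldots,X_k)$ is a finite sequence of nonempty subsets $X_i\subset X$ with $X=\bigcup_{i=1}^k X_i$ (the $X_i$ may overlap). For sets $A,B$, $\mathcal{C}(A,B)$ denotes the set of correspondences, i.e. subsets $C\subset A\times B$ whose coordinate projections to $A$ and to $B$ are both surjective. For $C\in\mathcal{C}(X_i,Y_i)$, $C'\in\mathcal{C}(X_j,Y_j)$, let $\mathrm{dis}(C,C'):=\sup_{(x,y)\in C,\ (x',y')\in C'}|d_X(x,x')-d_Y(y,y')|$, and $$\mathsf{GH}_k(\mathcal{X},\mathcal{Y}):=\frac12\inf_{(C_1,\ldots,C_k)}\ \max_{i,j=1,\ldots,k}\mathrm{dis}(C_i,C_j),\qquad C_i\in\mathcal{C}(X_i,Y_i).$$ Fix a field $\mathbb{F}$. For a poset $Q$, a $Q$-module is a functor $V:Q\to\mathrm{Vect}_{\mathbb{F}}$ from the poset category $Q$ to $\mathbb{F}$-vector spaces; morphisms of $Q$-modules are natural transformations. For a poset $(P,\preccurlyeq)$, $\mathbb{R}\times P$ has the product order. For an $(\mathbb{R}\times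 P)$-module $V$ and $\epsilon\ge0$, the shift $V_\epsilon$ is $V_\epsilon(r,p):=V(r+\epsilon,p)$ (with the corresponding structure maps). Modules $V,V'$ are $\epsilon$-interleaved if there are morphisms $\phi:V\to V'_\epsilon$ and $\psi:V'\to V_\epsilon$ such that $\psi_{r+\epsilon,p}\circ\phi_{r,p}=V((r,p)\preccurlyeq(r+2\epsilon,p))$ and $\phi_{r+\epsilon,p}\circ\psi_{r,p}=V'((r,p)\preccurlyeq(r+2\epsilon,p))$ for all $(r,p)\in\mathbb{R}\times P$. Then $\mathsf{Int}(V,V'):=\inf\{\epsilon\ge0 : V,V'\text{ are }\epsilon\text{-interleaved}\}$, with $\inf\emptyset:=+\infty$. $P_k$ is the power set of $\{1,\ldots,k\}$ ordered by inclusion. For a metric space $S$, the Vietoris-Rips complex $\mathrm{VR}_r(S)$ is the simplicial complex whose simplices are the nonempty finite subsets $\sigma\subset S$ with $\mathrm{diam}(\sigma)\le r$ (it is empty if $r<0$ or $S=\emptyset$). The labeled persistent homology $\mathrm{LPH}_j(\mathcal{X})$ is the $(\mathbb{R}\times P_k)$-module $\mathrm{LPH}_j(\mathcal{X})(r,p):=\mathrm{H}_j(\mathrm{VR}_r(\bigcup_{i\in p}X_i))$ (degree-$j$ simplicial homology with coefficients in $\mathbb{F}$), with structure maps induced by inclusions. *)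

(* Defs.v *)
From HB Require Import structures.
From mathcomp Require Import freeg.
From mathcomp Require Import all_boot all_order all_fingroup all_algebra.
From mathcomp Require Import generic_quotient ring_quotient.
From mathcomp Require Import all_classical all_reals ereal topology.

Set Implicit Arguments.
Unset Strict Implicit.
Unset Printing Implicit Defensive.

Import Order.TTheory GRing.Theory Num.Theory.
(* Makes {set 'I_k} a poset for inclusion. *)
Import Order.DefaultSetSubsetOrder.

Local Open Scope classical_set_scope.
Local Open Scope quotient_scope.
Local Open Scope ring_scope.

Definition span (F : fieldType) (V : lmodType F) (S : set V) : set V :=
  smallest (fun W : set V =>
    W 0 /\ forall (a : F) u v, W u -> W v -> W (a *: u + v)) S.

Section Span.
Variables (F : fieldType) (V : lmodType F) (S : set V).

Definition in_span : {pred V} := fun v => `[< span S v >].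

Lemma sub_span v : S v -> span S v.
Proof. by move=> Sv W [_]; apply. Qed.

Lemma span0 : span S 0.
Proof. by move=> W [[]]. Qed.

Lemma spanP a u v : span S u -> span S v -> span S (a *: u + v).
Proof. by move=> Su Sv W WP; exact: (WP.1.2 _ _ _ (Su _ WP) (Sv _ WP)). Qed.

Lemma spanZ a u : span S u -> span S (a *: u).
Proof. by move=> Su; rewrite -[_ *: _]addr0; apply: spanP => //; exact: span0. Qed.

Lemma spanD u v : span S u -> span S v -> span S (u + v).
Proof. by move=> Su Sv; rewrite -[u]scale1r; exact: spanP. Qed.

Lemma in_span_zmod : zmod_closed in_span.
Proof.
split=> [|u v /asboolP Su /asboolP Sv]; apply/asboolP; first exact: span0.
by rewrite addrC -scaleN1r; exact: spanP.
Qed.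

HB.instance Definition _ := GRing.isZmodClosed.Build V in_span in_span_zmod.

(* V / span S *)
Definition vquot : Type := Quotient.quot in_span.
HB.instance Definition _ := GRing.Zmodule.on vquot.

Definition vpi (v : V) : vquot := \pi_(Quotient.quot in_span) v.

Lemma vpi_eq u v : vpi u = vpi v <-> span S (u - v).
Proof.
rewrite /vpi; split=> [/eqP|h]; first by rewrite -Quotient.idealrBE => /asboolP.
by apply/eqP; rewrite -Quotient.idealrBE; apply/asboolP.
Qed.

Definition vrepr (q : vquot) : V := repr (q : Quotient.quot in_span).

Lemma vreprK : cancel vrepr vpi.
Proof. exact: reprK. Qed.

Lemma vpi_repr v : span S (vrepr (vpi v) - v).
Proof. by apply/vpi_eq; rewrite vreprK. Qed.

Lemma vpiD : {morph vpi : u v / u + v}.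
Proof. exact: Quotient.pi_add. Qed.

Definition vscale (a : F) (q : vquot) : vquot := vpi (a *: vrepr q).

Lemma vpi_scale a v : vscale a (vpi v) = vpi (a *: v).
Proof. by apply/vpi_eq; rewrite -scalerBr; apply: spanZ; exact: vpi_repr. Qed.

Lemma vscaleA a b q : vscale a (vscale b q) = vscale (a * b) q.
Proof. by rewrite -[q]vreprK !vpi_scale scalerA. Qed.

Lemma vscale1 : left_id 1 vscale.
Proof. by move=> q; rewrite -[q]vreprK vpi_scale scale1r. Qed.

Lemma vscaleDr : right_distributive vscale +%R.
Proof.
by move=> a p q; rewrite -[p]vreprK -[q]vreprK -vpiD !vpi_scale -vpiD scalerDr.
Qed.

Lemma vscaleDl q : {morph vscale^~ q : a b / a + b}.
Proof. by move=> a b; rewrite -[q]vreprK !vpi_scale -vpiD scalerDl. Qed.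

HB.instance Definition _ := GRing.Zmodule_isLmodule.Build F vquot
  vscaleA vscale1 vscaleDr vscaleDl.

Lemma vpi_is_linear : linear vpi.
Proof. by move=> a u v; rewrite vpiD -vpi_scale. Qed.

HB.instance Definition _ := GRing.isLinear.Build F V vquot _ vpi vpi_is_linear.

End Span.

Section QuotientMap.
Variables (F : fieldType) (V W : lmodType F) (S : set V) (B : set W).
Variable g : {linear V -> W}.

Definition vquot_map (_ : forall v, S v -> span B (g v)) (q : vquot S) :
  vquot B := vpi B (g (vrepr q)).

Hypothesis SB : forall v, S v -> span B (g v).

Lemma span_linear v : span S v -> span B (g v).
Proof.
move=> Sv; apply: (Sv (fun v => span B (g v))); split=> //.
split=> [|a u w Bu Bw]; first by rewrite linear0; exact: span0.
by rewrite linearP; exact: spanP.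
Qed.

Lemma vquot_mapE v : vquot_map SB (vpi S v) = vpi B (g v).
Proof.
by apply/vpi_eq; rewrite -linearB; apply: span_linear; exact: vpi_repr.
Qed.

Lemma vquot_map_is_linear : linear (vquot_map SB).
Proof.
move=> a p q; rewrite -[p]vreprK -[q]vreprK -linearP !vquot_mapE.
by rewrite !linearP.
Qed.

HB.instance Definition _ := GRing.isLinear.Build F (vquot S) (vquot B) _
  (vquot_map SB) vquot_map_is_linear.

End QuotientMap.

Lemma scale_freegU (F : fieldType) (I : choiceType) (a b : F) (i : I) :
  a *: << b *g i >> = << (a * b) *g i >>.
Proof. by apply/eqP/freeg_eqP => j; rewrite coeffZ !coeffU mulrA. Qed.

Section FreeLift.
Variables (F : fieldType) (I : choiceType) (V : lmodType F) (f : I -> V).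

Definition free_lift (x : {freeg I / F}) : V := fglift f x.

Lemma free_liftU a i : free_lift << a *g i >> = a *: f i.
Proof. exact: liftU. Qed.

Lemma free_lift_is_zmod_morphism : zmod_morphism free_lift.
Proof. exact: lift_is_additive. Qed.

HB.instance Definition _ := GRing.isZmodMorphism.Build {freeg I / F} V
  free_lift free_lift_is_zmod_morphism.

Lemma free_lift_is_scalable : scalable free_lift.
Proof.
move=> a x; rewrite -(freeg_sumE x) scaler_sumr !raddf_sum /=.
by apply: eq_bigr => i _; rewrite scale_freegU !free_liftU scalerA.
Qed.

HB.instance Definition _ := GRing.isScalable.Build F {freeg I / F} V _
  free_lift free_lift_is_scalable.

End FreeLift.

Lemma free_linear_ext (F : fieldType) (I : choiceType) (V : lmodType F)
    (f g : {linear {freeg I / F} -> V}) :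
  (forall i, f << i >> = g << i >>) -> f =1 g.
Proof.
move=> fg x; rewrite -(freeg_sumE x) !raddf_sum; apply: eq_bigr => i _ /=.
by rewrite -[coeff i x]mulr1 -scale_freegU !linearZ /= fg.
Qed.

Record simplicialComplex (T : Type) := SimplicialComplex {
  simplex : set (set T);
  simplex_finite : forall s, simplex s -> finite_set s;
  simplex_nonempty : forall s, simplex s -> s !=set0;
  simplex_sub : forall s t, simplex s -> t `<=` s -> t !=set0 -> simplex t
}.

Definition simplicial (T U : Type) (K : simplicialComplex T)
  (L : simplicialComplex U) (f : T -> U) := forall s, simplex K s -> simplex L (f @` s).

Section OrderedSimplices.
Variables (T : choiceType) (K : simplicialComplex T).

(* Tuples (v_0, ..., v_n), repetitions allowed, of vertices spanning a        *)
(* simplex of K.                                                              *)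
Definition osimplex (n : nat) : choiceType :=
  set_type [set v : {ffun 'I_n.+1 -> T} | simplex K (range v)].

Definition mk_osimplex n (v : {ffun 'I_n.+1 -> T})
    (Kv : simplex K (range v)) : osimplex n :=
  SigSub (mem_set (Kv : [set v : {ffun 'I_n.+1 -> T} | simplex K (range v)] v)).

Definition vertex n (v : osimplex n) : {ffun 'I_n.+1 -> T} := val v.

Lemma osimplexP n (v : osimplex n) : simplex K (range (vertex v)).
Proof. by have /set_mem := valP v. Qed.

Lemma osimplex_eq n (v w : osimplex n) : vertex v =1 vertex w -> v = w.
Proof. by move=> vw; apply/val_inj/ffunP. Qed.

Lemma face_subproof n (v : osimplex n.+1) (i : 'I_n.+2) :
  simplex K (range [ffun j => vertex v (lift i j)]).
Proof.
apply: (simplex_sub (osimplexP v)).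
  by move=> _ [j _ <-]; rewrite ffunE; exists (lift i j).
by exists ([ffun j => vertex v (lift i j)] ord0), ord0.
Qed.

Definition face n (v : osimplex n.+1) (i : 'I_n.+2) : osimplex n :=
  mk_osimplex (face_subproof v i).

Lemma vertex_face n (v : osimplex n.+1) i j :
  vertex (face v i) j = vertex v (lift i j).
Proof. by rewrite /vertex /= ffunE. Qed.

End OrderedSimplices.

Section Chains.
Variables (F : fieldType) (T : choiceType) (K : simplicialComplex T).

(* Oriented chains: the free space on ordered simplices, where degenerate     *)
(* tuples vanish and permuting vertices multiplies by the sign.               *)
Definition orientation n : set {freeg (osimplex K n) / F} :=
  [set << v >> | v in [set v : osimplex K n | ~ injective (vertex v)]] `|`
  [set x | exists (v w : osimplex K n) (s : 'S_n.+1),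
     (forall i, vertex w i = vertex v (s i)) /\
     x = << w >> - (-1) ^+ s *: << v >>].

Definition chain n : lmodType F := vquot (@orientation n).

Definition free_boundary n : {freeg (osimplex K n.+1) / F} ->
    {freeg (osimplex K n) / F} :=
  free_lift (fun v => \sum_(i < n.+2) (-1) ^+ i *: << face v i >>).

HB.instance Definition _ n := GRing.Linear.on (@free_boundary n).

Lemma perm_lift n (s : 'S_n.+1) (i : 'I_n.+1) :
  exists t : 'S_n, s = lift_perm i (s i) t.
Proof.
have h k : s i != s (lift i k) by rewrite (inj_eq perm_inj) neq_lift.
pose g k := s2val (unlift_some (h k)).
have gE k : s (lift i k) = lift (s i) (g k).
  by rewrite /g; case: unlift_some.
have ginj : injective g.
  move=> j k gjk; apply: (@lift_inj _ i); apply: (@perm_inj _ s).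
  by rewrite !gE gjk.
exists (perm ginj); apply/permP => j.
case: (unliftP i j) => [k ->|->]; last by rewrite lift_perm_id.
by rewrite lift_perm_lift gE permE.
Qed.

Lemma face_perm n (v w : osimplex K n.+1) (s : 'S_n.+2) (i : 'I_n.+2) :
  (forall j, vertex w j = vertex v (s j)) ->
  exists2 t : 'S_n.+1,
    (forall j, vertex (face w i) j = vertex (face v (s i)) (t j)) &
    (s : bool) = odd i (+) odd (s i) (+) t.
Proof.
move=> wv; have [t st] := perm_lift s i.
exists t => [j|]; last by rewrite {1}st odd_lift_perm.
by rewrite !vertex_face wv {1}st lift_perm_lift.
Qed.

Lemma span_sum (V : lmodType F) (S : set V) (I : Type) (r : seq I)
    (P : pred I) (f : I -> V) :
  (forall i, P i -> span S (f i)) -> span S (\sum_(i <- r | P i) f i).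
Proof.
by move=> h; apply: (big_ind (span S)) => //; [exact: span0|exact: spanD].
Qed.

Lemma orientation_perm n (v w : osimplex K n) (s : 'S_n.+1) :
  (forall i, vertex w i = vertex v (s i)) ->
  span (@orientation n) (<< w >> - (-1) ^+ s *: << v >>).
Proof. by move=> vw; apply: sub_span; right; exists v, w, s. Qed.

Lemma free_boundary_orientation n x :
  @orientation n.+1 x -> span (@orientation n) (free_boundary x).
Proof.
case=> [[v /= vN <-]|[v [w [s [wv ->]]]]].
- have [a [b [ab vab]]] : exists a b, a != b /\ vertex v a = vertex v b.
    apply: contrapT => h; apply: vN => a b vab; apply: contrapT => ab.
    by apply: h; exists a, b; split=> //; apply/eqP.
  rewrite /free_boundary free_liftU scale1r (bigD1 a) //= (bigD1 b) /=; last first.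
    by rewrite eq_sym.
  rewrite addrA; apply: spanD; last first.
    apply: span_sum => i /andP[ia ib]; apply: spanZ; apply: sub_span; left.
    exists (face v i) => //= vi.
    have [a' aE _] := unlift_some ia; have [b' bE _] := unlift_some ib.
    move: ab; rewrite aE bE => /negP; apply; apply/eqP; congr lift.
    by apply: vi; rewrite !vertex_face -aE -bE.
  have vv j : vertex v j = vertex v (tperm a b j).
    by case: tpermP => [->|->|].
  have [t + tE] := face_perm a vv; rewrite tpermL => vt.
  rewrite odd_tperm ab tpermL in tE.
  rewrite [X in span _ X](_ : _ =
    (-1) ^+ a *: (<< face v a >> - (-1) ^+ t *: << face v b >>)).
    by apply: spanZ; apply: orientation_perm => j; rewrite vt.
  rewrite scalerBr scalerA; congr (_ + _); rewrite -scaleNr; congr (_ *: _).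
  rewrite -signr_odd -[(-1) ^+ a]signr_odd -signr_addb -signrN.
  by congr (_ ^+ _); case: (odd a) (odd b) (t : bool) tE => [] [] [].
- rewrite linearB linearZ /= /free_boundary !free_liftU !scale1r.
  rewrite [X in _ - _ *: X](reindex_inj (@perm_inj _ s)) /= scaler_sumr -sumrB.
  apply: span_sum => i _; have [t wvt tE] := face_perm i wv.
  rewrite [X in span _ X](_ : _ =
    (-1) ^+ i *: (<< face w i >> - (-1) ^+ t *: << face v (s i) >>)).
    by apply: spanZ; exact: orientation_perm.
  rewrite scalerBr !scalerA; congr (_ - _ *: _).
  rewrite -[(-1) ^+ i]signr_odd -[(-1) ^+ (s i)]signr_odd -!signr_addb.
  by rewrite tE; case: (odd i) (odd (s i)) (t : bool) => [] [] [].
Qed.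

Definition boundary n : chain n.+1 -> chain n :=
  vquot_map (@free_boundary_orientation n).
HB.instance Definition _ n := GRing.Linear.on (@boundary n).

(* Every 0-chain is a cycle: the homology is not reduced. *)
Definition is_cycle n : chain n -> Prop :=
  match n with 0 => fun=> True | m.+1 => fun c => boundary c = 0 end.

Definition cycle_pred n : {pred chain n} := fun c => `[< is_cycle c >].

Lemma cycle_submod n : submod_closed (@cycle_pred n).
Proof.
split=> [|a c d /asboolP hc /asboolP hd]; apply/asboolP.
  by case: n => //= n; rewrite linear0.
by case: n => //= n in c d hc hd *; rewrite linearP /= hc hd scaler0 addr0.
Qed.

HB.instance Definition _ n :=
  GRing.isSubmodClosed.Build F (chain n) (@cycle_pred n) (@cycle_submod n).

Record cycle n := Cycle { cycle_val : chain n; _ : cycle_val \in @cycle_pred n }.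

HB.instance Definition _ n := [isSub for @cycle_val n].
HB.instance Definition _ n := [Choice of cycle n by <:].
HB.instance Definition _ n :=
  [SubChoice_isSubLmodule of cycle n by <:].

Definition boundaries n : set (cycle n) :=
  [set z | exists d : chain n.+1, val z = boundary d].

(* ker / im: [boundaries] is already a subspace, so spanning adds nothing.    *)
Definition homology n : lmodType F := vquot (@boundaries n).

End Chains.

Section InducedMap.
Variables (F : fieldType) (T U : choiceType).
Variables (K : simplicialComplex T) (L : simplicialComplex U) (f : T -> U).
Hypothesis Kf : simplicial K L f.

Lemma osimplex_map_subproof n (v : osimplex K n) :
  simplex L (range [ffun i => f (vertex v i)]).
Proof.
suff -> : range [ffun i => f (vertex v i)] = f @` range (vertex v).
  by apply: Kf; exact: osimplexP.
by rewrite image_comp; apply: eq_imagel => i _; rewrite /= ffunE.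
Qed.

Definition osimplex_map n (v : osimplex K n) : osimplex L n :=
  mk_osimplex (osimplex_map_subproof v).

Lemma vertex_osimplex_map n (v : osimplex K n) i :
  vertex (osimplex_map v) i = f (vertex v i).
Proof. by rewrite /vertex /= ffunE. Qed.

Lemma face_osimplex_map n (v : osimplex K n.+1) i :
  face (osimplex_map v) i = osimplex_map (face v i).
Proof.
apply: osimplex_eq => j.
by rewrite vertex_face !vertex_osimplex_map vertex_face.
Qed.

Definition free_map n : {freeg (osimplex K n) / F} -> {freeg (osimplex L n) / F} :=
  free_lift (fun v => << osimplex_map v >>).
HB.instance Definition _ n := GRing.Linear.on (@free_map n).

Lemma free_mapU n (v : osimplex K n) :
  free_map << v >> = << osimplex_map v >>.
Proof. by rewrite /free_map free_liftU scale1r. Qed.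

Lemma free_map_orientation n x :
  orientation x -> span (@orientation F _ L n) (free_map x).
Proof.
case=> [[v /= vN <-]|[v [w [s [wv ->]]]]]; apply: sub_span.
  left; exists (osimplex_map v); rewrite /= ?free_mapU // => fv; apply: vN.
  by move=> i j vij; apply: fv; rewrite !vertex_osimplex_map vij.
right; exists (osimplex_map v), (osimplex_map w), s; split.
  by move=> i; rewrite !vertex_osimplex_map wv.
by rewrite linearB linearZ /= !free_mapU.
Qed.

Lemma free_map_boundary n (x : {freeg (osimplex K n.+1) / F}) :
  free_boundary (free_map x) = free_map (free_boundary x).
Proof.
apply: (free_linear_ext (f := @free_boundary F U L n \o @free_map n.+1)
  (g := @free_map n \o @free_boundary F T K n)) => v /=.
rewrite free_mapU /free_boundary !free_liftU !scale1r linear_sum /=.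
by apply: eq_bigr => i _; rewrite linearZ /= free_mapU face_osimplex_map.
Qed.

Definition chain_map n : chain F K n -> chain F L n :=
  vquot_map (@free_map_orientation n).
HB.instance Definition _ n := GRing.Linear.on (@chain_map n).

Lemma chain_map_boundary n (c : chain F K n.+1) :
  boundary (chain_map c) = chain_map (boundary c).
Proof.
rewrite -[c]vreprK /chain_map /boundary !vquot_mapE.
by rewrite /= free_map_boundary.
Qed.

Lemma cycle_map_subproof n (z : cycle F K n) :
  chain_map (val z) \in @cycle_pred F U L n.
Proof.
have /asboolP := valP z; case: n z => [|n] z hz; apply/asboolP => //=.
by rewrite chain_map_boundary hz linear0.
Qed.

Definition cycle_map n (z : cycle F K n) : cycle F L n :=
  Cycle (cycle_map_subproof z).

Lemma cycle_map_is_linear n : linear (@cycle_map n).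
Proof. by move=> a y z; apply: val_inj; rewrite /= !linearP. Qed.

HB.instance Definition _ n := GRing.isLinear.Build F (cycle F K n) (cycle F L n)
  _ (@cycle_map n) (@cycle_map_is_linear n).

Lemma cycle_map_boundaries n z :
  @boundaries F T K n z -> span (@boundaries F U L n) (cycle_map z).
Proof.
move=> [d zd]; apply: sub_span; exists (chain_map d).
by rewrite chain_map_boundary -zd.
Qed.

Definition homology_map n : homology F K n -> homology F L n :=
  vquot_map (@cycle_map_boundaries n).
HB.instance Definition _ n := GRing.Linear.on (@homology_map n).

End InducedMap.

Section Functoriality.
Variables (F : fieldType) (T U W : choiceType).
Variables (K : simplicialComplex T) (L : simplicialComplex U).
Variables (M : simplicialComplex W).

Lemma homology_map_id (Kid : simplicial K K id) n (h : homology F K n) :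
  homology_map Kid h = h.
Proof.
rewrite -[RHS]vreprK -{1}[h]vreprK /homology_map vquot_mapE; congr vpi.
apply: val_inj => /=; move: (val _) => c.
rewrite -[RHS]vreprK -{1}[c]vreprK /chain_map vquot_mapE; congr vpi.
apply: (free_linear_ext (f := @free_map F T T K K id Kid n) (g := idfun)) => v.
rewrite /= free_mapU; congr << _ >>; apply: osimplex_eq => i.
by rewrite vertex_osimplex_map.
Qed.

Lemma homology_map_comp (f : T -> U) (g : U -> W) (Kf : simplicial K L f)
    (Lg : simplicial L M g) (Kgf : simplicial K M (g \o f)) n
    (h : homology F K n) :
  homology_map Lg (homology_map Kf h) = homology_map Kgf h.
Proof.
rewrite -[h]vreprK /homology_map !vquot_mapE; congr vpi.
apply: val_inj => /=; move: (val _) => c.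
rewrite -[c]vreprK /chain_map !vquot_mapE; congr vpi.
apply: (free_linear_ext (f := @free_map F _ _ L M g Lg n \o
  @free_map F _ _ K L f Kf n) (g := @free_map F _ _ K M (g \o f) Kgf n)) => v.
rewrite /= !free_mapU; congr << _ >>; apply: osimplex_eq => i.
by rewrite !vertex_osimplex_map.
Qed.

End Functoriality.

Record pmodule (F : fieldType) (d : Order.disp_t) (Q : porderType d) := PModule {
  pm_obj :> Q -> lmodType F;
  pm_map : forall a b : Q, (a <= b)%O -> {linear pm_obj a -> pm_obj b};
  pm_map_id : forall (a : Q) (h : (a <= a)%O) x, pm_map h x = x;
  pm_map_comp : forall (a b c : Q) (hab : (a <= b)%O) (hbc : (b <= c)%O)
    (hac : (a <= c)%O) x, pm_map hbc (pm_map hab x) = pm_map hac x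
}.

Record pmorphism (F : fieldType) (d : Order.disp_t) (Q : porderType d)
    (V W : pmodule F Q) := PMorphism {
  pm_comp :> forall q : Q, {linear V q -> W q};
  pm_natural : forall (a b : Q) (h : (a <= b)%O) x,
    pm_comp b (pm_map V h x) = pm_map W h (pm_comp a x)
}.

Section Interleaving.
Variables (R : realType) (d : Order.disp_t) (P : porderType d).
Variable F : fieldType.
Local Notation RP := (R *p P)%type.

Definition shift_index (e : R) (q : RP) : RP := (q.1 + e, q.2).

Lemma shift_index_le e (a b : RP) :
  (a <= b)%O -> (shift_index e a <= shift_index e b)%O.
Proof. by rewrite !leEprod /= lerD2r. Qed.

Lemma le_shift_index2 e (q : RP) :
  0 <= e -> (q <= shift_index e (shift_index e q))%O.
Proof. by move=> e0; rewrite leEprod /= lexx andbT -addrA lerDl addr_ge0. Qed.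

Definition shift (V : pmodule F RP) (e : R) : pmodule F RP.
Proof.
refine (@PModule F _ RP (fun q => V (shift_index e q))
  (fun a b h => pm_map V (shift_index_le e h)) _ _).
- by move=> a h x; exact: pm_map_id.
- by move=> a b c hab hbc hac x; exact: pm_map_comp.
Defined.

(* The index (r + 2e, p) appears as (r + e + e, p). *)
Definition interleaved (e : R) (V W : pmodule F RP) : Prop :=
  exists (e0 : 0 <= e) (phi : pmorphism V (shift W e))
         (psi : pmorphism W (shift V e)),
    (forall (q : RP) (x : V q),
      psi (shift_index e q) (phi q x) = pm_map V (le_shift_index2 q e0) x) /\
    (forall (q : RP) (y : W q),
      phi (shift_index e q) (psi q y) = pm_map W (le_shift_index2 q e0) y).

Definition interleaving_distance (V W : pmodule F RP) : \bar R :=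
  ereal_inf [set e%:E | e in [set e | interleaved e V W]].

End Interleaving.

Record labeledMetricSpace (R : realType) (k : nat) := LabeledMetricSpace {
  lms_space :> metricType R;
  lms_compact : compact [set: lms_space];
  label : 'I_k -> set lms_space;
  label_nonempty : forall i, label i !=set0;
  label_cover : \bigcup_i label i = [set: lms_space]
}.

Arguments label {R k} X i : rename.

Section GromovHausdorff.
Variable R : realType.

Definition correspondence (S T : Type) (A : set S) (B : set T) :
    set (set (S * T)) :=
  [set C | [/\ C `<=` A `*` B, fst @` C = A & snd @` C = B]].

Definition dis (X Y : metricType R) (C C' : set (X * Y)) : \bar R :=
  ereal_sup [set `|mdist p.1 q.1 - mdist p.2 q.2|%:E | p in C & q in C'].

(* For k > 0 the value is finite, the spaces being compact and the labels     *)
(* nonempty. *)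
Definition GH (k : nat) (X Y : labeledMetricSpace R k) : \bar R :=
  ((2^-1)%:E * ereal_inf
    [set \big[maxe/-oo]_(ij : 'I_k * 'I_k) dis (C ij.1) (C ij.2) | C in
      [set C : 'I_k -> set (X * Y) |
        forall i, correspondence (label X i) (label Y i) (C i)]])%E.

End GromovHausdorff.

Section LabeledPersistentHomology.
Variables (R : realType).

Definition diam (X : metricType R) (A : set X) : \bar R :=
  ereal_sup [set (mdist p.1 p.2)%:E | p in A `*` A].

Lemma diam_le (X : metricType R) (A B : set X) :
  A `<=` B -> (diam A <= diam B)%E.
Proof.
by move=> AB; apply: ereal_sup_le => _ [p [p1 p2] <-]; exists p => //; split; apply: AB.
Qed.

(* As a complex on the vertex type X; its vertices all lie in S. *)
Definition VR (X : metricType R) (r : R) (S : set X) : simplicialComplex X.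
Proof.
refine (@SimplicialComplex X
  [set s | [/\ finite_set s, s !=set0, s `<=` S & (diam s <= r%:E)%E]] _ _ _).
- by move=> s [].
- by move=> s [].
- move=> s t [sfin _ sS sr] ts t0; split=> //.
  + exact: sub_finite_set sfin.
  + exact: subset_trans sS.
  + exact: le_trans (diam_le ts) sr.
Defined.

Lemma VR_inclusion (X : metricType R) (r r' : R) (S S' : set X) :
  r <= r' -> S `<=` S' -> simplicial (VR r S) (VR r' S') id.
Proof.
move=> rr SS s; rewrite image_id => -[? ? sS sr]; split=> //.
  exact: subset_trans SS.
by apply: le_trans sr _; rewrite lee_fin.
Qed.

Variables (k : nat) (X : labeledMetricSpace R k) (F : fieldType).

Definition sublabel (p : {set 'I_k}) : set X :=
  \bigcup_(i in [set i | i \in p]) label X i.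

Lemma sublabel_le (p p' : {set 'I_k}) : (p <= p')%O -> sublabel p `<=` sublabel p'.
Proof.
move=> /fintype.subsetP pp' x [i /= ip Xi]; exists i => //=.
exact: pp'.
Qed.

Definition LVR (q : R *p {set 'I_k}) : simplicialComplex X :=
  VR q.1 (sublabel q.2).

Lemma LVR_inclusion (a b : R *p {set 'I_k}) :
  (a <= b)%O -> simplicial (LVR a) (LVR b) id.
Proof.
by rewrite leEprod => /andP[h1 h2]; apply: VR_inclusion => //; exact: sublabel_le.
Qed.

Definition LPH (j : nat) : pmodule F (R *p {set 'I_k})%type.
Proof.
refine (@PModule F _ _ (fun q => homology F (LVR q) j)
  (fun a b h => @homology_map F _ _ _ _ id (LVR_inclusion h) j) _ _).
- by move=> a h x; exact: homology_map_id.
- by move=> a b c hab hbc hac x; exact: homology_map_comp.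
Defined.

End LabeledPersistentHomology.

(* Main.v *)
(* If every dis(C_i, C_j) is at most e, choose for each set of labels p a map *)
(* f_p with (x, f_p x) in C_i for some i in p whenever x lies in the union of *)
(* the X_i, i in p, and maps g_p likewise from Y to X. The f_p depend on p, so *)
(* they do not commute with the inclusions strictly; but since dis(C_i, C_j)  *)
(* is controlled for i <> j as well, f_p and f_p' are contiguous for p <= p'. *)
(* Likewise g_p \o f_p is contiguous to the inclusion. Contiguous maps agree  *)
(* on homology, so the f_p and g_p induce an e-interleaving.                  *)

Require Import Defs.
From HB Require Import structures.
From mathcomp Require Import freeg.
From mathcomp Require Import all_boot all_order all_fingroup all_algebra.
From mathcomp Require Import all_classical all_reals ereal topology.
(* [span] is also a name of the vector library. *)
Import Defs.

Set Implicit Arguments.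
Unset Strict Implicit.
Unset Printing Implicit Defensive.

Import Order.TTheory GRing.Theory Num.Theory.
Import Order.DefaultSetSubsetOrder.

Local Open Scope classical_set_scope.
Local Open Scope ring_scope.

(** Any family of correspondences with all distortions at most e should give an e-interleaving; the
    factor 2 then cancels the 1/2 in [GH]. Such a family enters only through a [label_relation], a
    notion symmetric in the two spaces, so [LPH_selection] yields both morphisms. Naturality and the
    two round trips all compare vertex maps that select from a common relation of bounded
    distortion. Such maps are contiguous by [contiguous_VR], hence equal on homology by
    [homology_map_contiguous], which rests on the chain homotopy of [homotopyP]. *)

(** * Generators of the oriented chain spaces and maps between them *)

Section SimplexChain.
Variables (F : fieldType) (T : choiceType) (K : simplicialComplex T).

Definition simplex_chain n (v : osimplex K n) : chain F K n :=
  vpi (@orientation F T K n) << v >>.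

Lemma simplex_chain_degenerate n (v : osimplex K n) :
  ~ injective (vertex v) -> simplex_chain v = 0.
Proof.
move=> vN; rewrite /simplex_chain -(linear0 (vpi _)); apply/vpi_eq.
by rewrite subr0; apply: sub_span; left; exists v.
Qed.

Lemma simplex_chain_perm n (v w : osimplex K n) (s : 'S_n.+1) :
  (forall i, vertex w i = vertex v (s i)) ->
  simplex_chain w = (-1) ^+ s *: simplex_chain v.
Proof.
move=> wv; rewrite /simplex_chain -linearZ; apply/vpi_eq.
exact: orientation_perm.
Qed.

Lemma boundary_simplex_chain n (v : osimplex K n.+1) :
  boundary (simplex_chain v) =
  \sum_(i < n.+2) (-1) ^+ i *: simplex_chain (face v i).
Proof.
rewrite /boundary vquot_mapE /= /free_boundary free_liftU scale1r linear_sum.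
by apply: eq_bigr => i _; rewrite linearZ.
Qed.

Lemma chain_sumE n (x : {freeg (osimplex K n) / F}) :
  vpi (@orientation F T K n) x =
  \sum_(v <- freeg.dom x) coeff v x *: simplex_chain v.
Proof.
rewrite -[in LHS](freeg_sumE x) linear_sum; apply: eq_bigr => v _.
by rewrite /= -[coeff v x]mulr1 -scale_freegU linearZ mulr1.
Qed.

Lemma chain_linear_ext n (V : lmodType F) (f g : {linear chain F K n -> V}) :
  (forall v, f (simplex_chain v) = g (simplex_chain v)) -> f =1 g.
Proof.
move=> fg c; rewrite -[c]vreprK chain_sumE !linear_sum.
by apply: eq_bigr => v _; rewrite !linearZ /= fg.
Qed.

End SimplexChain.

Section ChainMap.
Variables (F : fieldType) (T U : choiceType).
Variables (K : simplicialComplex T) (L : simplicialComplex U).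

Lemma chain_map_simplex_chain (f : T -> U) (Kf : simplicial K L f) n
    (v : osimplex K n) :
  chain_map Kf (simplex_chain F v) = simplex_chain F (osimplex_map Kf v).
Proof. by rewrite /chain_map vquot_mapE /= free_mapU. Qed.

Lemma homology_map_eq (f g : T -> U) (Kf : simplicial K L f)
    (Kg : simplicial K L g) n (z : cycle F K n) d :
  chain_map Kf (val z) - chain_map Kg (val z) = boundary d ->
  homology_map Kf (vpi _ z) = homology_map Kg (vpi _ z).
Proof.
move=> fgd; rewrite /homology_map !vquot_mapE; apply/vpi_eq; apply: sub_span.
by exists d; rewrite raddfB.
Qed.

End ChainMap.

(** * Contiguous maps and their effect on homology *)

Definition contiguous (T U : Type) (K : simplicialComplex T)
    (L : simplicialComplex U) (f g : T -> U) :=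
  forall s, simplex K s -> simplex L (f @` s `|` g @` s).

Section Contiguous.
Variables (T U : Type) (K : simplicialComplex T) (L : simplicialComplex U).

(** Serves the hybrid maps that follow [g] on some vertices and [f] on the others. *)
Lemma contiguous_sub (f g f' g' : T -> U) : contiguous K L f g ->
  (forall x, f' x = f x \/ f' x = g x) ->
  (forall x, g' x = f x \/ g' x = g x) ->
  contiguous K L f' g'.
Proof.
move=> fg f'E g'E s Ks; apply: (simplex_sub (fg _ Ks)).
  move=> _ [[x sx <-]|[x sx <-]].
    by case: (f'E x) => ->; [left|right]; exists x.
  by case: (g'E x) => ->; [left|right]; exists x.
by have [x sx] := simplex_nonempty Ks; exists (f' x); left; exists x.
Qed.

Lemma contiguous_simplicial (f g : T -> U) :
  contiguous K L f g -> simplicial K L f.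
Proof.
move=> fg s Ks; apply: (simplex_sub (fg _ Ks)); first by move=> y; left.
by have [x sx] := simplex_nonempty Ks; exists (f x), x.
Qed.

End Contiguous.

(* The usual prism operator depends on an ordering of the vertices and does   *)
(* not descend to oriented chains. When f and g differ at one vertex w only,  *)
(* v |-> (g w, f v_0, ..., f v_n) if w is a vertex of v, and 0 otherwise, is  *)
(* a chain homotopy that does. If w is not a vertex of v, [cone v] is a junk  *)
(* value.                                                                     *)
Section OneVertexHomotopy.
Variables (F : fieldType) (T U : choiceType).
Variables (K : simplicialComplex T) (L : simplicialComplex U) (f g : T -> U).
Variable w : T.
Hypotheses (Kf : simplicial K L f) (Kg : simplicial K L g).
Hypothesis fg_contiguous : contiguous K L f g.
Hypothesis fg_eq : forall x, x != w -> g x = f x.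

Definition has_vertex n (v : osimplex K n) := [exists i, vertex v i == w].

Lemma cone_subproof n (v : osimplex K n) :
  simplex L (range [ffun i : 'I_n.+2 => if unlift ord0 i is Some j
    then f (vertex v j) else if has_vertex v then g w else f (vertex v ord0)]).
Proof.
apply: (simplex_sub (fg_contiguous (osimplexP v))); last first.
  by eexists; exists ord0.
move=> _ [i _ <-]; rewrite ffunE; case: unliftP => [j _|_].
  by left; exists (vertex v j) => //; exists j.
case: ifPn => [/existsP[j /eqP <-]|_].
  by right; exists (vertex v j) => //; exists j.
by left; exists (vertex v ord0) => //; exists ord0.
Qed.

Definition cone n (v : osimplex K n) : osimplex L n.+1 :=
  mk_osimplex (cone_subproof v).

Lemma vertex_cone_lift n (v : osimplex K n) j :
  vertex (cone v) (lift ord0 j) = f (vertex v j).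
Proof. by rewrite /vertex /= ffunE liftK. Qed.

Lemma vertex_cone0 n (v : osimplex K n) :
  has_vertex v -> vertex (cone v) ord0 = g w.
Proof. by move=> vw; rewrite /vertex /= ffunE unlift_none vw. Qed.

Definition free_cone n (v : osimplex K n) : {freeg (osimplex L n.+1) / F} :=
  if has_vertex v then << cone v >> else 0.

(** The apex [g w] does not depend on where [w] sits in the tuple. So a permutation of the tuple
    extends to the cone by fixing the apex, with the same sign, and a repeated vertex makes the cone
    degenerate or the value 0. *)
Lemma free_cone_orientation n x : @orientation F T K n x ->
  span (@orientation F U L n.+1) (free_lift (@free_cone n) x).
Proof.
case=> [[v /= vN <-]|[v [u [s [uv ->]]]]].
  rewrite free_liftU scale1r /free_cone; case: ifP => _; last exact: span0.
  apply: sub_span; left; exists (cone v) => //= cv; apply: vN => i j vij.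
  by apply: (@lift_inj _ ord0); apply: cv; rewrite !vertex_cone_lift vij.
have uvw : has_vertex u = has_vertex v.
  apply/existsP/existsP => -[i /eqP <-]; first by exists (s i); rewrite uv.
  by exists (s^-1%g i); rewrite uv permKV.
rewrite linearB linearZ /= !free_liftU !scale1r /free_cone uvw.
case: ifPn => vw; last by rewrite scaler0 subr0; exact: span0.
apply: sub_span; right; exists (cone v), (cone u), (lift_perm ord0 ord0 s).
split=> [i|]; last by rewrite odd_lift_perm.
case: (unliftP ord0 i) => [j|] ->.
  by rewrite lift_perm_lift !vertex_cone_lift uv.
by rewrite lift_perm_id !vertex_cone0 // uvw.
Qed.

Definition homotopy n : chain F K n -> chain F L n.+1 :=
  vquot_map (@free_cone_orientation n).
HB.instance Definition _ n := GRing.Linear.on (@homotopy n).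

Lemma homotopy_simplex_chain n (v : osimplex K n) :
  homotopy (simplex_chain F v) =
  if has_vertex v then simplex_chain F (cone v) else 0.
Proof.
rewrite /homotopy vquot_mapE /= free_liftU scale1r /free_cone.
by case: ifP => // _; rewrite linear0.
Qed.

(** Dropping the apex leaves the image under [f]. Dropping [f w] leaves the image under [g], except
    that [g w] stands in front instead of at position [a]. *)
Lemma boundary_cone n (v : osimplex K n) a :
  injective (vertex v) -> vertex v a = w ->
  boundary (simplex_chain F (cone v)) =
    chain_map Kf (simplex_chain F v) - chain_map Kg (simplex_chain F v)
    - \sum_(i < n.+1 | i != a)
        (-1) ^+ i *: simplex_chain F (face (cone v) (lift ord0 i)).
Proof.
move=> vi va; have vw : has_vertex v by apply/existsP; exists a; rewrite va.
rewrite boundary_simplex_chain big_ord_recl expr0 scale1r -addrA.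
congr (_ + _).
  rewrite chain_map_simplex_chain; congr simplex_chain.
  apply: osimplex_eq => j.
  by rewrite vertex_face vertex_cone_lift vertex_osimplex_map.
rewrite (bigD1 a) //= -sumrN; congr (_ + _); last first.
  by apply: eq_bigr => i _; rewrite exprS mulN1r scaleNr.
rewrite chain_map_simplex_chain.
(* This permutation moves entry [a] to the front and has sign (-1)^a; with the sign (-1)^(a+1) of
   the face it leaves -1. *)
rewrite (@simplex_chain_perm F _ _ _ (osimplex_map Kg v) _
  (lift_perm ord0 a 1)).
  rewrite odd_lift_perm odd_perm1 addbF scalerA /bump add1n exprS mulN1r.
  by rewrite signr_odd mulNr -expr2 sqrr_sign scaleN1r.
move=> i; rewrite vertex_face vertex_osimplex_map.
case: (unliftP ord0 i) => [j|] ->.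
  rewrite lift_perm_lift perm1.
  have -> : lift (lift ord0 a) (lift ord0 j) = lift ord0 (lift a j).
    by apply: val_inj; rewrite /= /bump !add1n ltnS addnS.
  rewrite vertex_cone_lift fg_eq // -va (inj_eq vi).
  by rewrite eq_sym neq_lift.
rewrite lift_perm_id va -(vertex_cone0 vw); congr (vertex _ _).
exact: val_inj.
Qed.

(** By injectivity only face [a] loses [w], and the homotopy kills it; coning any other face gives a
    face of the cone. The sum cancels the one in [boundary_cone]. *)
Lemma homotopy_boundary_cone n (v : osimplex K n.+1) a :
  injective (vertex v) -> vertex v a = w ->
  homotopy (boundary (simplex_chain F v)) =
  \sum_(i < n.+2 | i != a)
    (-1) ^+ i *: simplex_chain F (face (cone v) (lift ord0 i)).
Proof.
move=> vi va; rewrite boundary_simplex_chain linear_sum (bigD1 a) //=.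
have /negbTE fa : ~~ has_vertex (face v a).
  apply/existsP => -[j]; rewrite vertex_face -va (inj_eq vi) eq_sym.
  by rewrite (negbTE (neq_lift _ _)).
rewrite linearZ /= homotopy_simplex_chain fa scaler0 add0r.
apply: eq_bigr => i ia; have [b ab _] := unlift_some ia.
have fi : has_vertex (face v i).
  by apply/existsP; exists b; rewrite vertex_face -ab va.
have vw : has_vertex v by apply/existsP; exists a; rewrite va.
rewrite linearZ /= homotopy_simplex_chain fi.
congr (_ *: simplex_chain F _); apply: osimplex_eq => j; rewrite vertex_face.
case: (unliftP ord0 j) => [j'|] ->; last first.
  rewrite vertex_cone0 // -(vertex_cone0 vw); congr (vertex _ _).
  exact: val_inj.
rewrite vertex_cone_lift vertex_face -vertex_cone_lift; congr (vertex _ _).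
by apply: val_inj; rewrite /= /bump !add1n ltnS addnS.
Qed.

Lemma has_vertexPn n (v : osimplex K n) :
  ~~ has_vertex v -> forall i, vertex v i != w.
Proof. by move=> vw i; apply: contra vw => vi; apply/existsP; exists i. Qed.

Lemma chain_map_avoid n (v : osimplex K n) : ~~ has_vertex v ->
  chain_map Kf (simplex_chain F v) = chain_map Kg (simplex_chain F v).
Proof.
move=> /has_vertexPn vw; rewrite !chain_map_simplex_chain; congr simplex_chain.
by apply: osimplex_eq => i; rewrite !vertex_osimplex_map fg_eq.
Qed.

Lemma homotopyP0 (c : chain F K 0) :
  chain_map Kf c - chain_map Kg c = boundary (homotopy c).
Proof.
apply: (chain_linear_ext (f := @chain_map F T U K L f Kf 0 \-
  @chain_map F T U K L g Kg 0) (g := @boundary F U L 0 \o @homotopy 0)) => v.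
rewrite /= homotopy_simplex_chain.
case: ifPn => [vw|/chain_map_avoid ->]; last by rewrite subrr linear0.
rewrite (@boundary_cone _ v ord0); last 2 first.
- by move=> i j _; rewrite !ord1.
- by move/existsP: vw => [i]; rewrite ord1 => /eqP.
by rewrite big_pred0 ?subr0 // => i; rewrite ord1.
Qed.

Lemma homotopyP n (c : chain F K n.+1) :
  chain_map Kf c - chain_map Kg c =
  boundary (homotopy c) + homotopy (boundary c).
Proof.
apply: (chain_linear_ext (f := @chain_map F T U K L f Kf n.+1 \-
  @chain_map F T U K L g Kg n.+1)
  (g := (@boundary F U L n.+1 \o @homotopy n.+1) \+
        (@homotopy n \o @boundary F T K n))) => v.
rewrite /=.
have [vi|vN] := pselect (injective (vertex v)); last first.
  by rewrite simplex_chain_degenerate // 2!linear0 subrr !linear0 addr0.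
rewrite homotopy_simplex_chain; case: ifPn => [/existsP[a /eqP va]|vw].
  by rewrite (boundary_cone vi va) (homotopy_boundary_cone vi va) subrK.
rewrite chain_map_avoid // subrr linear0 add0r boundary_simplex_chain.
rewrite linear_sum big1 // => i _; rewrite linearZ /=.
rewrite homotopy_simplex_chain ifF ?scaler0 //; apply/negbTE/existsP => -[j].
by rewrite vertex_face; apply/negP/has_vertexPn.
Qed.

Lemma homology_map_one_vertex n (h : homology F K n) :
  homology_map Kf h = homology_map Kg h.
Proof.
rewrite -[h]vreprK; move: (vrepr h) => z.
have /asboolP := valP z; case: n h z => [_ z _|n _ z zcycle].
  by apply: homology_map_eq; exact: homotopyP0.
apply: homology_map_eq; rewrite homotopyP; move: zcycle => /= ->.
by rewrite linear0 addr0.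
Qed.

End OneVertexHomotopy.

Section ContiguousHomology.
Variables (F : fieldType) (T U : choiceType).
Variables (K : simplicialComplex T) (L : simplicialComplex U).

(** Agreement is asked only on the finitely many vertices of a chosen representative. *)
Lemma homology_map_agree (f g : T -> U) (Kf : simplicial K L f)
    (Kg : simplicial K L g) n (z : cycle F K n) :
  {in freeg.dom (vrepr (val z)), forall v i, f (vertex v i) = g (vertex v i)} ->
  homology_map Kf (vpi _ z) = homology_map Kg (vpi _ z).
Proof.
move=> fg; apply: (homology_map_eq (d := 0)); apply/eqP.
rewrite linear0 subr_eq0 -[val z]vreprK chain_sumE !linear_sum; apply/eqP.
apply: eq_big_seq => v /fg fgv; rewrite !linearZ /= !chain_map_simplex_chain.
congr (_ *: simplex_chain F _).
by apply: osimplex_eq => i; rewrite !vertex_osimplex_map.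
Qed.

(* A cycle involves only finitely many vertices, so f can be turned into g on *)
(* all of them by moving one vertex at a time.                                *)
Lemma homology_map_contiguous (f g : T -> U) (Kf : simplicial K L f)
    (Kg : simplicial K L g) n (h : homology F K n) :
  contiguous K L f g -> homology_map Kf h = homology_map Kg h.
Proof.
move=> fg; rewrite -[h]vreprK; move: (vrepr h) => z.
pose m (s : seq T) x := if x \in s then g x else f x.
have mfg (s : seq T) x : m s x = f x \/ m s x = g x.
  by rewrite /m; case: ifP => _; [right|left].
have Km s : simplicial K L (m s).
  exact: contiguous_simplicial (contiguous_sub fg (mfg s) (mfg s)).
have mE s : homology_map Kf (vpi _ z) = homology_map (Km s) (vpi _ z).
  elim: s => [|w s ->]; first exact: homology_map_agree.
  apply: (homology_map_one_vertex (w := w)).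
    exact: contiguous_sub fg (mfg _) (mfg _).
  by move=> x xw; rewrite /m in_cons (negbTE xw).
rewrite (mE (flatten [seq codom (vertex v) | v <- freeg.dom (vrepr (val z))])).
apply: homology_map_agree => v zv i; rewrite /m ifT //.
by apply/flatten_mapP; exists v => //; exact: codom_f.
Qed.

End ContiguousHomology.

Lemma homology_map_comp_contiguous (F : fieldType) (T U W : choiceType)
    (K : simplicialComplex T) (L : simplicialComplex U)
    (M : simplicialComplex W) (f : T -> U) (g : U -> W) (u : T -> W)
    (Kf : simplicial K L f) (Lg : simplicial L M g) (Ku : simplicial K M u) n
    (h : homology F K n) : contiguous K M (g \o f) u ->
  homology_map Lg (homology_map Kf h) = homology_map Ku h.
Proof.
move=> gfu; have Kgf := contiguous_simplicial gfu.
by rewrite (homology_map_comp Kf Lg Kgf); exact: homology_map_contiguous.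
Qed.

(** * Contiguity in Vietoris-Rips complexes *)

Section VietorisRips.
Variable R : realType.

Lemma diam_leP (X : metricType R) (A : set X) (r : R) :
  (diam A <= r%:E)%E <-> (forall x y, A x -> A y -> mdist x y <= r).
Proof.
split=> [Ar x y Ax Ay|Ar].
  rewrite -lee_fin; apply: le_trans Ar; apply: ereal_sup_ubound.
  by exists (x, y).
by apply: ge_ereal_sup => _ [[x y] [/= Ax Ay] <-]; rewrite lee_fin Ar.
Qed.

(** Two image points, even one under [f] and one under [g], are related to points of the same
    simplex, so their distance is at most r + e. *)
Lemma contiguous_VR (X Y : metricType R) (r e : R) (S : set X) (S' : set Y)
    (rel : X -> Y -> Prop) (f g : X -> Y) :
  (forall x y, rel x y -> S' y) ->
  (forall x y x' y', rel x y -> rel x' y' -> mdist y y' <= mdist x x' + e) ->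
  (forall x, S x -> rel x (f x)) -> (forall x, S x -> rel x (g x)) ->
  contiguous (VR r S) (VR (r + e) S') f g.
Proof.
move=> relS' rele Sf Sg s [sfin [x sx] sS /diam_leP sr].
have fgs y : (f @` s `|` g @` s) y -> exists2 x, s x & rel x y.
  by case=> -[x' sx' <-]; exists x' => //; [exact/Sf/sS|exact/Sg/sS].
split.
- by rewrite finite_setU; split; exact: finite_image.
- by exists (f x); left; exists x.
- by move=> y /fgs[x' _]; exact: relS'.
- apply/diam_leP => y y' /fgs[z sz zy] /fgs[z' sz' zy'].
  by apply: le_trans (rele _ _ _ _ zy zy') _; rewrite lerD2r sr.
Qed.

End VietorisRips.

(** * From relations to interleavings *)

Section LabelRelation.
Variables (R : realType) (k : nat).

(* To be read as: (x, y) lies in C_i for some i in p.                         *)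
Record label_relation (X Y : labeledMetricSpace R k) (e : R)
    (rel : {set 'I_k} -> X -> Y -> Prop) : Prop := LabelRelation {
  lrel_mono : forall p p' x y, (p <= p')%O -> rel p x y -> rel p' x y;
  lrel_dom : forall p x, sublabel (X := X) p x <-> exists y, rel p x y;
  lrel_cod : forall p y, sublabel (X := Y) p y <-> exists x, rel p x y;
  lrel_dist : forall p x y x' y', rel p x y -> rel p x' y' ->
    `|mdist x x' - mdist y y'| <= e
}.

Lemma label_relation_flip X Y e rel : @label_relation X Y e rel ->
  label_relation (X := Y) (Y := X) e (fun p y x => rel p x y).
Proof.
case=> mono dom cod dist; split=> //; first by move=> p p' y x; exact: mono.
by move=> p y x y' x' xy xy'; rewrite distrC; exact: dist xy xy'.
Qed.

Lemma lrel_dist_le X Y e rel : @label_relation X Y e rel ->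
  forall p x y x' y', rel p x y -> rel p x' y' -> mdist y y' <= mdist x x' + e.
Proof.
move=> relP p x y x' y' xy xy'; rewrite -lerBlDl.
by apply: le_trans (lrel_dist relP xy xy'); rewrite distrC ler_norm.
Qed.

Definition label_selection (X Y : labeledMetricSpace R k)
    (rel : {set 'I_k} -> X -> Y -> Prop) (f : {set 'I_k} -> X -> Y) :=
  forall p x, sublabel (X := X) p x -> rel p x (f p x).

Lemma exists_label_selection X Y e rel : (0 < k)%N ->
  @label_relation X Y e rel -> exists f, label_selection rel f.
Proof.
(* [y0] is the value outside the labels in [p]; it exists because k > 0. *)
move=> k_gt0 relP; have [y0 _] := label_nonempty Y (Ordinal k_gt0).
suff /choice[f fP] : forall px : {set 'I_k} * X, exists y,
    sublabel (X := X) px.1 px.2 -> rel px.1 px.2 y.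
  by exists (fun p x => f (p, x)) => p x; exact: (fP (p, x)).
move=> [p x] /=.
have [/(lrel_dom relP)[y xy]|xNp] := pselect (sublabel (X := X) p x).
  by exists y.
by exists y0.
Qed.

Section Map.
Variables (F : fieldType) (j : nat) (X Y : labeledMetricSpace R k) (e : R).
Variables (rel : {set 'I_k} -> X -> Y -> Prop) (f : {set 'I_k} -> X -> Y).
Hypotheses (relP : label_relation e rel) (f_rel : label_selection rel f).

(** By monotonicity both selections lie in the single relation [rel b.2]. *)
Lemma contiguous_selection (a b : R *p {set 'I_k}) (p p' : {set 'I_k}) :
  (a <= b)%O -> (a.2 <= p <= b.2)%O -> (a.2 <= p' <= b.2)%O ->
  contiguous (LVR X a) (LVR Y (shift_index e b)) (f p) (f p').
Proof.
rewrite leEprod => /andP[ab1 _] /andP[ap pb] /andP[ap' pb'].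
suff fVR : contiguous (VR b.1 (sublabel (X := X) a.2))
    (LVR Y (shift_index e b)) (f p) (f p').
  by move=> s sa; apply: fVR; rewrite -(image_id s); exact: VR_inclusion sa.
apply: (contiguous_VR (rel := rel b.2)).
- by move=> x y xy; apply/(lrel_cod relP); exists x.
- by move=> x y x' y'; exact: lrel_dist_le.
- move=> x /(sublabel_le ap)/f_rel; exact: (lrel_mono relP).
- move=> x /(sublabel_le ap')/f_rel; exact: (lrel_mono relP).
Qed.

Lemma simplicial_selection (q : R *p {set 'I_k}) :
  simplicial (LVR X q) (LVR Y (shift_index e q)) (f q.2).
Proof.
apply: (@contiguous_simplicial _ _ _ _ _ (f q.2)).
by apply: contiguous_selection; rewrite ?lexx.
Qed.

Definition LPH_selection : pmorphism (LPH X F j) (shift (LPH Y F j) e).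
Proof.
refine (@PMorphism F _ _ (LPH X F j) (shift (LPH Y F j) e)
  (fun q => @homology_map F _ _ _ _ _ (@simplicial_selection q) j) _).
move=> a b ab x /=.
have ab2 : (a.2 <= b.2)%O by move: ab; rewrite leEprod => /andP[].
(* Both sides of the naturality square are compared with the map induced by [f b.2]. *)
have Kb : simplicial (LVR X a) (LVR Y (shift_index e b)) (f b.2).
  apply: (@contiguous_simplicial _ _ _ _ _ (f b.2)).
  by apply: contiguous_selection; rewrite ?ab2 ?lexx.
rewrite (homology_map_comp_contiguous _ _ Kb); last first.
  by apply: contiguous_selection; rewrite ?ab2 ?lexx.
rewrite (homology_map_comp_contiguous _ _ Kb) //.
by apply: contiguous_selection; rewrite ?ab2 ?lexx.
Defined.

End Map.

Lemma LPH_selectionK F j X Y e rel f g (relP : @label_relation X Y e rel)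
    (flipP : label_relation e (fun p y x => rel p x y))
    (f_rel : label_selection rel f)
    (g_rel : label_selection (fun p y x => rel p x y) g) (e0 : 0 <= e)
    (q : R *p {set 'I_k}) (h : LPH X F j q) :
  LPH_selection F j flipP g_rel (shift_index e q)
    (LPH_selection F j relP f_rel q h) =
  pm_map (LPH X F j) (le_shift_index2 q e0) h.
Proof.
apply: homology_map_comp_contiguous; rewrite /LVR /= -addrA.
(* Points with a common partner form a relation of distortion at most e + e, which contains both (x,
   g (f x)) and (x, x). *)
apply: (contiguous_VR
  (rel := fun x x' => exists2 y, rel q.2 x y & rel q.2 x' y)).
- by move=> x x' [y _ x'y]; apply/(lrel_dom relP); exists y.
- move=> x1 x1' x2 x2' [y1 xy1 xy1'] [y2 xy2 xy2']; rewrite addrA.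
  apply: le_trans (lrel_dist_le flipP xy1' xy2') _.
  by rewrite lerD2r; exact: (lrel_dist_le relP xy1 xy2).
- move=> x /f_rel xf; exists (f q.2 x) => //.
  by apply: g_rel; apply/(lrel_cod relP); exists x.
- by move=> x /f_rel xf; exists (f q.2 x).
Qed.

Lemma label_relation_interleaved F j X Y e rel : (0 < k)%N -> 0 <= e ->
  @label_relation X Y e rel -> interleaved e (LPH X F j) (LPH Y F j).
Proof.
move=> k_gt0 e0 relP; have flipP := label_relation_flip relP.
have [f f_rel] := exists_label_selection k_gt0 relP.
have [g g_rel] := exists_label_selection k_gt0 flipP.
exists e0, (LPH_selection F j relP f_rel), (LPH_selection F j flipP g_rel).
(* The second round trip is the first one for the flipped relation. *)
by split=> q h; apply: LPH_selectionK.
Qed.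

Lemma correspondences_label_relation (X Y : labeledMetricSpace R k)
    (C : 'I_k -> set (X * Y)) (e : R) :
  (forall i, correspondence (label X i) (label Y i) (C i)) ->
  (forall i j, (dis (C i) (C j) <= e%:E)%E) ->
  label_relation e (fun p x y => exists2 i, i \in p & C i (x, y)).
Proof.
move=> CP Ce; split.
- by move=> p p' x y /fintype.subsetP pp' [i ip xy]; exists i => //; exact: pp'.
- move=> p x; split=> [[i /= ip]|[y [i ip xy]]]; have [_ CX _] := CP i.
    by rewrite -CX => -[[x' y] xy /= <-]; exists y, i.
  by exists i => //=; rewrite -CX; exists (x, y).
- move=> p y; split=> [[i /= ip]|[x [i ip xy]]]; have [_ _ CY] := CP i.
    by rewrite -CY => -[[x y'] xy /= <-]; exists x, i.
  by exists i => //=; rewrite -CY; exists (x, y).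
- move=> p x y x' y' [i _ xy] [i' _ xy']; rewrite -lee_fin.
  apply: le_trans (Ce i i'); apply: ereal_sup_ubound.
  by exists (x, y) => //; exists (x', y').
Qed.

End LabelRelation.

Theorem theorem3p2p2 (R : realType) (F : fieldType) (k : nat) (k_gt0 : (0 < k)%N)
    (X Y : labeledMetricSpace R k) (j : nat) :
  (interleaving_distance (LPH X F j) (LPH Y F j) <= 2%:E * GH X Y)%E.
Proof.
rewrite /GH muleA -EFinM divff ?pnatr_eq0 // mul1e.
apply: le_ereal_inf_tmp => _ [C CP <-].
set m := (X in (_ <= X)%E).
have Cm i i' : (dis (C i) (C i') <= m)%E.
  pose d (ij : 'I_k * 'I_k) := dis (C ij.1) (C ij.2).
  exact: (le_bigmax _ d (i, i')).
(* Comparing a pair of [C i] with itself gives distortion 0. This excludes the value -oo, the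
   default of an empty maximum. *)
have m_ge0 : (0 <= m)%E.
  pose i := Ordinal k_gt0; apply: le_trans (Cm i i).
  have [x Xx] := label_nonempty X i; have [_ CX _] := CP i.
  move: Xx; rewrite -CX => -[xy Cxy _]; apply: ereal_sup_ubound.
  by exists xy => //; exists xy => //; rewrite !mdistxx subrr normr0.
case: m Cm m_ge0 => [e| |] Cm m_ge0; [|exact: leey|by []].
apply: ereal_inf_lbound; exists e => //.
apply: (label_relation_interleaved _ _ k_gt0); first by rewrite -lee_fin.
exact: correspondences_label_relation CP Cm.
Qed.
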